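(* Suppose there exists a sequence $G_1,G_2,\dots$ of finite groups such that $\alpha(G_i)=2+o(1)$ as $i\to\infty$, and furthermore $\alpha(G_i)-2=o(\gamma(G_i)-2)$ as $i\to\infty$. Then the exponent of matrix multiplication over $\mathbb{C}$ is $\omega=2$.
   Context: For a subset $S$ of a group, $Q(S)=\{s_1s_2^{-1}: s_1,s_2\in S\}$. A group $G$ realizes $\langle n_1,n_2,n_3\rangle$ if there are subsets $S_1,S_2,S_3\subseteq G$ with $|S_i|=n_i$ such that for all $q_i\in Q(S_i)$, if $q_1q_2q_3=1$ then $q_1=q_2=q_3=1$. The pseudo-exponent $\alpha(G)$ of a non-trivial finite group $G$ is the minimum of $\frac{3\log|G|}{\log nmp}$ over all positive integers $n,m,p$ (not all $1$) such that $G$ realizes $\langle n,m,p\rangle$; the pseudo-exponent of the trivial group is $3$. For a finite group $G$, $\gamma(G)$ is defined so that $|G|^{1/\gamma(G)}$ is the maximum character degree of $G$ (the largest dimension of an irreducible complex representation), with $\gamma(G)=\infty$ if $G$ is abelian. The exponent $\omega$ is the smallest real number such that for each $\varepsilon>0$, two $n\times n$ complex matrices can be multiplied using $O(n^{\omega+\varepsilon})$ arithmetic operations. *)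

(* Defs.v *)
From HB Require Import structures.
From mathcomp Require Import all_boot all_order all_algebra all_fingroup.
From mathcomp Require Import pgroup mxrepresentation complex.
From mathcomp Require Import all_classical all_reals all_analysis.
Set Implicit Arguments.
Unset Strict Implicit.
Unset Printing Implicit Defensive.
Import Order.TTheory GRing.Theory Num.Theory.
Import numFieldNormedType.Exports.
Local Open Scope classical_set_scope.
Local Open Scope ring_scope.

Definition right_quotients (gT : finGroupType) (S : {set gT}) : {set gT} :=
  [set (s1 * s2^-1)%g | s1 in S, s2 in S]%SET.

Definition realizes (gT : finGroupType) (G : {group gT}) (n m p : nat) : Prop :=
  exists S1 S2 S3 : {set gT},
    [/\ S1 \subset G, S2 \subset G & S3 \subset G] /\
    [/\ #|S1| = n, #|S2| = m & #|S3| = p] /\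
    forall q1 q2 q3 : gT,
      q1 \in right_quotients S1 -> q2 \in right_quotients S2 ->
      q3 \in right_quotients S3 ->
      (q1 * q2 * q3 = 1)%g -> [/\ q1 = 1%g, q2 = 1%g & q3 = 1%g].

Definition pseudo_exponent_ratios (R : realType) (gT : finGroupType)
    (G : {group gT}) : set R :=
  [set a | exists n m p : nat,
     [/\ (0 < n)%N, (0 < m)%N & (0 < p)%N] /\
     ~ [/\ n = 1%N, m = 1%N & p = 1%N] /\
     realizes G n m p /\
     a = 3 * ln (#|G|%:R) / ln ((n * m * p)%N%:R)].

Arguments pseudo_exponent_ratios R {gT} G.

(* For a nontrivial group the infimum is a minimum: see pseudo_exponent_min. *)
Definition pseudo_exponent (R : realType) (gT : finGroupType)
    (G : {group gT}) : R :=
  if #|G| == 1%N then 3 else inf (pseudo_exponent_ratios R G).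

Definition irreducible_dim (R : realType) (gT : finGroupType) (G : {group gT})
    (d : nat) : Prop :=
  exists rG : mx_representation (complex R) G d, mx_irreducible rG.

(* Bounding d by #|G| loses nothing: see irreducible_dim_le. *)
Definition max_character_degree (R : realType) (gT : finGroupType)
    (G : {group gT}) : nat :=
  (\max_(d < #|G|.+1 | `[< irreducible_dim R G d >]) d)%N.

(* In the nonabelian case this solves |G|^(1/gamma) = max degree for gamma:
   see gammaP. *)
Definition gamma (R : realType) (gT : finGroupType) (G : {group gT}) : \bar R :=
  if abelian G then +oo%E
  else (ln (#|G|%:R) / ln ((max_character_degree R G)%:R))%:E.

Inductive arith_op := OpAdd | OpSub | OpMul | OpDiv.

(* [Reg k] is the result of the k-th instruction (counted from 0). *)
Inductive operand (F I : Type) := Const of F | Input of I | Reg of nat.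

Arguments Const {F I} _.
Arguments Input {F I} _.
Arguments Reg {F I} _.

Definition instruction (F I : Type) : Type :=
  (arith_op * operand F I * operand F I)%type.

Definition eval_operand (F I : Type) (x : I -> F) (regs : seq F)
    (o : operand F I) : option F :=
  match o with
  | Const c => Some c
  | Input i => Some (x i)
  | Reg k => onth regs k
  end.

Definition eval_op (F : fieldType) (op : arith_op) (a b : F) : option F :=
  match op with
  | OpAdd => Some (a + b)
  | OpSub => Some (a - b)
  | OpMul => Some (a * b)
  | OpDiv => if b == 0 then None else Some (a / b)
  end.

Definition eval_instruction (F : fieldType) (I : Type) (x : I -> F)
    (regs : seq F) (ins : instruction F I) : option F :=
  let: (op, o1, o2) := ins in
  match eval_operand x regs o1, eval_operand x regs o2 with
  | Some a, Some b => eval_op op a b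
  | _, _ => None
  end.

(* [None] signals a division by zero or a reference to a result that has not
   been computed yet. *)
Fixpoint run (F : fieldType) (I : Type) (x : I -> F) (regs : seq F)
    (prog : seq (instruction F I)) : option (seq F) :=
  match prog with
  | [::] => Some regs
  | ins :: prog' =>
      match eval_instruction x regs ins with
      | Some v => run x (rcons regs v) prog'
      | None => None
      end
  end.

(* [inl (i, j)] stands for the (i, j) entry of the left factor and
   [inr (i, j)] for that of the right factor. *)
Definition matmul_input (n : nat) : Type :=
  ('I_n * 'I_n + 'I_n * 'I_n)%type.

Definition matmul_entries (F : fieldType) (n : nat) (A B : 'M[F]_n)
    (v : matmul_input n) : F :=
  match v with
  | inl ij => A ij.1 ij.2
  | inr ij => B ij.1 ij.2
  end.

Definition computes_matmul (F : fieldType) (n : nat)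
    (prog : seq (instruction F (matmul_input n)))
    (out : 'I_n -> 'I_n -> operand F (matmul_input n)) : Prop :=
  forall A B : 'M[F]_n, exists regs : seq F,
    run (matmul_entries A B) [::] prog = Some regs /\
    forall i j : 'I_n,
      eval_operand (matmul_entries A B) regs (out i j) = Some ((A *m B) i j).

(* Every arithmetic operation costs one; constants, inputs and copies are
   free. *)
Definition matmul_in_ops (F : fieldType) (n N : nat) : Prop :=
  exists (prog : seq (instruction F (matmul_input n)))
         (out : 'I_n -> 'I_n -> operand F (matmul_input n)),
    size prog = N /\ computes_matmul prog out.

Definition matmul_in_power (R : realType) (F : fieldType) (t : R) : Prop :=
  exists K : R, forall n : nat, (0 < n)%N ->
    exists N : nat, matmul_in_ops F n N /\ N%:R <= K * (n%:R `^ t).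

(* The set contains its infimum, because of the quantification over eps. *)
Definition matmul_exponent (R : realType) : R :=
  inf [set w : R | forall eps : R, 0 < eps ->
         matmul_in_power (complex R) (w + eps)].

Lemma pseudo_exponent_ratios_finite (R : realType) (gT : finGroupType)
    (G : {group gT}) :
  finite_set (pseudo_exponent_ratios R G).
Proof.
pose ratio (t : 'I_#|G|.+1 * 'I_#|G|.+1 * 'I_#|G|.+1) : R :=
  3 * ln (#|G|%:R) / ln ((t.1.1 * t.1.2 * t.2)%N%:R).
apply: (@sub_finite_set _ _ (ratio @` setT)); last first.
  apply: finite_image; exact: finite_finset.
move=> a [n [m [p [_ [_ [[S1 [S2 [S3 [[s1 s2 s3] [[c1 c2 c3] _]]]]] ->]]]]]].
have h1 : (n < #|G|.+1)%N by rewrite ltnS -c1 subset_leq_card.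
have h2 : (m < #|G|.+1)%N by rewrite ltnS -c2 subset_leq_card.
have h3 : (p < #|G|.+1)%N by rewrite ltnS -c3 subset_leq_card.
by exists (Ordinal h1, Ordinal h2, Ordinal h3).
Qed.

Lemma realizes_card (gT : finGroupType) (G : {group gT}) : realizes G #|G| 1 1.
Proof.
exists G, [set 1%g]%SET, [set 1%g]%SET; split; first by split; rewrite ?finset.sub1set ?group1 ?subxx.
split; first by rewrite !cards1.
have Q1 (q : gT) : q \in right_quotients [set 1%g]%SET -> q = 1%g.
  by case/imset2P=> x y /set1P-> /set1P-> ->; rewrite invg1 mulg1.
by move=> q1 q2 q3 _ /Q1-> /Q1->; rewrite !mulg1.
Qed.

Lemma pseudo_exponent_min (R : realType) (gT : finGroupType) (G : {group gT}) :
  (#|G| != 1)%N ->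
  pseudo_exponent_ratios R G (pseudo_exponent R G) /\
  lbound (pseudo_exponent_ratios R G) (pseudo_exponent R G).
Proof.
move=> G1; rewrite /pseudo_exponent (negbTE G1).
set E := pseudo_exponent_ratios R G.
have E0 : E !=set0.
  exists (3 * ln (#|G|%:R) / ln ((#|G| * 1 * 1)%N%:R)); exists #|G|, 1%N, 1%N.
  split; first by rewrite cardG_gt0.
  split; first by case=> /eqP; rewrite (negbTE G1).
  by split; first exact: realizes_card.
have [s Es] : exists s : seq R, E = [set` s].
  by apply/finite_seqP; exact: pseudo_exponent_ratios_finite.
have [x0 Ex0] := E0.
have [x [Ex xmin]] : exists x, E x /\ lbound E x.
  have : x0 \in s by rewrite Es /= in Ex0.
  rewrite Es {E E0 Ex0 Es}; elim: s x0 => // a s IH x0 _.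
  case: s IH => [|b s] IH.
    by exists a; split => [|y]; rewrite /= !inE //= => /eqP->.
  have [x [xs xmin]] := IH b (mem_head _ _).
  have [ax|/ltW xa] := leP a x.
    exists a; split=> [|y /=]; first by rewrite /= mem_head.
    by rewrite inE => /orP[/eqP->//|ys]; apply: le_trans ax (xmin _ ys).
  exists x; split=> [|y /=]; first by rewrite /= inE xs orbT.
  by rewrite inE => /orP[/eqP->//|ys]; apply: xmin.
have -> : inf E = x; last by [].
apply/le_anti/andP; split; last exact: lb_le_inf.
by apply: ge_inf => //; exists x.
Qed.

Lemma complex_pchar_group (R : realType) (gT : finGroupType) (G : {group gT}) :
  ([pchar (complex R)]^'.-group G)%g.
Proof. by apply/pgroupP=> p pr _; rewrite inE /= pchar_num. Qed.

Lemma irreducible_dim_le (R : realType) (gT : finGroupType) (G : {group gT})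
    (d : nat) : irreducible_dim R G d -> (d <= #|G|)%N.
Proof.
case=> rG irrG; have F'G := complex_pchar_group R G.
have splitG : group_splitting_field (complex R) G.
  exact: group_closure_closed_field.
pose sG := DecSocleType (regular_repr (complex R) G).
have [f def_d _ _] := rsim_irr_comp_pchar sG F'G irrG.
set i := irr_comp sG rG in f def_d.
rewrite -(sum_irr_degree_pchar sG F'G splitG) (bigD1 i) //=.
apply: leq_trans (leq_addr _ _).
by rewrite [X in (X <= _)%N]def_d -mulnn leq_pmulr // irr_degree_gt0.
Qed.

Lemma max_character_degreeP (R : realType) (gT : finGroupType)
    (G : {group gT}) :
  irreducible_dim R G (max_character_degree R G) /\
  forall d : nat, irreducible_dim R G d -> (d <= max_character_degree R G)%N.
Proof.
pose sG := DecSocleType (regular_repr (complex R) G).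
have irr1 : irreducible_dim R G (irr_degree (principal_comp sG)).
  by exists (irr_repr (principal_comp sG)); apply: socle_irr.
pose P := [pred d : 'I_#|G|.+1 | `[< irreducible_dim R G d >]].
have P0 : (0 < #|P|)%N.
  have h := irreducible_dim_le irr1; rewrite -ltnS in h.
  by apply/card_gt0P; exists (Ordinal h); apply/asboolP.
split=> [|d dirr].
  rewrite /max_character_degree.
  have [i Pi ->] := eq_bigmax_cond (fun d : 'I_#|G|.+1 => val d) P0.
  exact/asboolP.
have h := irreducible_dim_le dirr; rewrite -ltnS in h.
rewrite /max_character_degree; apply: (bigop.leq_bigmax_cond (Ordinal h)); exact/asboolP.
Qed.

Lemma gammaP (R : realType) (gT : finGroupType) (G : {group gT}) :
  ~~ abelian G ->
  exists g : R, [/\ 0 < g, gamma R G = g%:E &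
    #|G|%:R `^ g^-1 = (max_character_degree R G)%:R].
Proof.
move=> abG; rewrite /gamma (negbTE abG).
have F'G := complex_pchar_group R G.
have splitG : group_splitting_field (complex R) G.
  exact: group_closure_closed_field.
pose sG := DecSocleType (regular_repr (complex R) G).
set M := max_character_degree R G.
have M1 : (1 < M)%N.
  rewrite ltnNge; apply: contra abG => M1; rewrite card_classes_abelian.
  rewrite -(card_irr_pchar sG F'G splitG).
  rewrite -(sum_irr_degree_pchar sG F'G splitG) -sum1_card; apply/eqP.
  apply: eq_bigr => i _; suff -> : irr_degree i = 1%N by [].
  apply/eqP; rewrite eqn_leq irr_degree_gt0 andbT; apply: leq_trans M1.
  apply: (max_character_degreeP R G).2.
  by exists (irr_repr i); apply: socle_irr.
have G1 : (1 < #|G|)%N.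
  by rewrite cardG_gt1; apply: contraNneq abG => ->; apply: abelian1.
have lnM : 0 < ln (M%:R : R) by rewrite ln_gt0 // ltr1n.
have lnG : 0 < ln (#|G|%:R : R) by rewrite ln_gt0 // ltr1n.
exists (ln (#|G|%:R) / ln (M%:R)); split => //; first by rewrite divr_gt0.
rewrite invf_div /powR pnatr_eq0 gtn_eqF ?(ltnW G1) //.
by rewrite divfK ?gt_eqF // lnK // posrE ltr0n ltnW.
Qed.

(* Main.v *)
Require Import Defs.
From HB Require Import structures.
From mathcomp Require Import all_boot all_order all_algebra all_fingroup.
From mathcomp Require Import pgroup mxrepresentation complex.
From mathcomp Require Import all_classical all_reals all_analysis.
From mathcomp Require Import ring lra zify.
Set Implicit Arguments.
Unset Strict Implicit.
Unset Printing Implicit Defensive.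
Import Order.TTheory GRing.Theory Num.Theory.
Import numFieldNormedType.Exports.
Local Open Scope classical_set_scope.
Local Open Scope ring_scope.

(* Let T be the set of real t such that the tensor of N x N matrix
   multiplication has rank O(N^t).  If G realizes <n,m,p> and the complex
   irreducible representations of G have dimensions d_i, then <nN,mN,pN>
   restricts to the direct sum of the <d_i N,d_i N,d_i N>; iterating this l
   times bounds the rank of <n^l,m^l,p^l> by O((sum_i d_i^t)^l) for every t in
   T, where sum_i d_i^t <= D^(t-2) |G| with D the largest d_i.  Symmetrizing,
   T is stable under t |-> alpha (1 + (t - 2) / gamma), whose only fixed point
   tends to 2 when alpha - 2 is small compared with 1 and with gamma - 2, so
   inf T = 2.  The argument stays at the level of ranks, hence no division has
   to be removed from arithmetic programs: a rank bound yields programs by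
   recursion on block matrices, and conversely n^2 operations are needed to
   produce the n^2 entries of the product. *)

(** * Bilinear rank of matrix multiplication *)

(* Coordinates of the identity tr (X Y Z) = sum_s u_s(X) v_s(Y) w_s(Z) for X, Y,
   Z indexed by A x B, B x C and C x A: a bilinear algorithm with r products,
   in a form invariant under rotation of A, B, C. *)
Definition mmrank_le (F : fieldType) (A B C : finType) (r : nat) : Prop :=
  exists (S : finType) (u : A -> B -> S -> F) (v : B -> C -> S -> F)
    (w : C -> A -> S -> F),
    (#|S| <= r)%N /\
    forall a b b' c c' a',
      \sum_s u a b s * v b' c s * w c' a' s
      = (a == a')%:R * (b == b')%:R * (c == c')%:R.

(** Pulling the coefficients back along injections preserves the three Kronecker deltas; this is the
    restriction of an algorithm to submatrices. *)
Lemma mmrank_le_inj (F : fieldType) (A B C A' B' C' : finType) (r r' : nat)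
    (f : A -> A') (g : B -> B') (h : C -> C') :
  injective f -> injective g -> injective h -> (r' <= r)%N ->
  mmrank_le F A' B' C' r' -> mmrank_le F A B C r.
Proof.
move=> fI gI hI rr [S [u [v [w [cS H]]]]].
exists S, (fun a b => u (f a) (g b)), (fun b c => v (g b) (h c)),
  (fun c a => w (h c) (f a)); split; first exact: leq_trans rr.
by move=> *; rewrite H !inj_eq.
Qed.

Lemma injection_of_card (A B : finType) :
  (#|A| <= #|B|)%N -> exists f : A -> B, injective f.
Proof.
move=> AB; exists (enum_val \o (widen_ord AB) \o enum_rank).
apply: inj_comp; last exact: enum_rank_inj.
apply: inj_comp; first exact: enum_val_inj.
by move=> i j /(congr1 val) /= /val_inj.
Qed.

Lemma mmrank_le_card (F : fieldType) (A B C A' B' C' : finType) (r r' : nat) :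
  (#|A| <= #|A'|)%N -> (#|B| <= #|B'|)%N -> (#|C| <= #|C'|)%N -> (r' <= r)%N ->
  mmrank_le F A' B' C' r' -> mmrank_le F A B C r.
Proof.
move=> /injection_of_card[f fI] /injection_of_card[g gI].
by move=> /injection_of_card[h hI]; apply: mmrank_le_inj fI gI hI.
Qed.

(** Cyclicity of the trace: tr (X Y Z) = tr (Y Z X). *)
Lemma mmrank_le_rot (F : fieldType) (A B C : finType) (r : nat) :
  mmrank_le F A B C r -> mmrank_le F B C A r.
Proof.
move=> [S [u [v [w [cS H]]]]]; exists S, v, w, u; split=> // b c c' a a' b'.
under eq_bigr do rewrite mulrC mulrA.
by rewrite H [a' == a]eq_sym [b' == b]eq_sym; ring.
Qed.

(** The tensor for product index types is the Kronecker product of the two tensors, so coefficients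
    multiply over pairs of products. *)
Lemma mmrank_le_prod (F : fieldType) (A B C A' B' C' : finType) (r r' : nat) :
  mmrank_le F A B C r -> mmrank_le F A' B' C' r' ->
  mmrank_le F (A * A')%type (B * B')%type (C * C')%type (r * r')%N.
Proof.
move=> [S [u [v [w [cS H]]]]] [S' [u' [v' [w' [cS' H']]]]].
exists (S * S')%type,
  (fun a b s => u a.1 b.1 s.1 * u' a.2 b.2 s.2),
  (fun a b s => v a.1 b.1 s.1 * v' a.2 b.2 s.2),
  (fun a b s => w a.1 b.1 s.1 * w' a.2 b.2 s.2); split.
  by rewrite card_prod leq_mul.
move=> [a1 a2] [b1 b2] [b1' b2'] [c1 c2] [c1' c2'] [a1' a2'] /=.
rewrite !xpair_eqE -!mulnb !natrM.
transitivity ((\sum_s u a1 b1 s * v b1' c1 s * w c1' a1' s) *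
              (\sum_s u' a2 b2 s * v' b2' c2 s * w' c2' a2' s)).
  rewrite big_distrlr /= pair_big /=; apply: eq_bigr => -[s s'] _ /=.
  by rewrite (mulrACA (u _ _ _)) (mulrACA (u _ _ _ * _)).
by rewrite H H'; ring.
Qed.

(** Schoolbook multiplication uses one product for each triple (a, b, c). *)
Lemma mmrank_le_trivial (F : fieldType) (A B C : finType) :
  mmrank_le F A B C (#|A| * #|B| * #|C|)%N.
Proof.
exists (A * B * C)%type, (fun a b s => ((s.1.1 == a) && (s.1.2 == b))%:R),
  (fun b c s => ((s.1.2 == b) && (s.2 == c))%:R),
  (fun c a s => ((s.2 == c) && (s.1.1 == a))%:R).
split; first by rewrite !card_prod.
move=> a b b' c c' a'; rewrite (bigD1 (a, b, c)) //= big1 => [|[[x y] z] /=].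
  by rewrite !eqxx !andbT addr0 -!mulnb !natrM mul1r; ring.
rewrite !xpair_eqE -!natrM !mulnb.
by case: (x == a) (y == b) (z == c) => [] [] [] //=;
  rewrite ?andbF ?andFb.
Qed.

(* The product of the three cyclic rotations of an [n x m] by [m x p]
   algorithm multiplies square matrices of size [n * m * p]. *)
Lemma mmrank_le_symmetrize (F : fieldType) (n m p r : nat) :
  mmrank_le F 'I_n 'I_m 'I_p r ->
  mmrank_le F 'I_(n * m * p) 'I_(n * m * p) 'I_(n * m * p) (r ^ 3).
Proof.
move=> H; have H2 := mmrank_le_rot H; have H3 := mmrank_le_rot H2.
have := mmrank_le_prod (mmrank_le_prod H H2) H3.
by apply: mmrank_le_card; rewrite ?card_prod ?card_ord //;
  [lia | lia | rewrite !expnS expn0; lia].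
Qed.

(** * The group algebra *)

Lemma sum_mul_delta (F : fieldType) (I : finType) (i : I) (f : I -> F) :
  \sum_j f j * (i == j)%:R = f i.
Proof.
rewrite (bigD1 i) //= eqxx mulr1 big1 ?addr0 // => j.
by rewrite eq_sym => /negPf->; rewrite mulr0.
Qed.

Lemma sum_mul3 (F : fieldType) (S I J K : finType)
    (f : I -> S -> F) (g : J -> S -> F) (h : K -> S -> F) :
  \sum_s (\sum_i f i s) * (\sum_j g j s) * (\sum_k h k s)
  = \sum_i \sum_j \sum_k \sum_s f i s * g j s * h k s.
Proof.
under [RHS]eq_bigr do under eq_bigr do rewrite exchange_big.
under [RHS]eq_bigr do rewrite exchange_big.
rewrite [RHS]exchange_big; apply: eq_bigr => s _ /=.
rewrite big_distrlr big_distrl /=; apply: eq_bigr => i _.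
by rewrite big_distrl /=; apply: eq_bigr => j _; rewrite big_distrr.
Qed.

Lemma mxtrace_mul3 (F : fieldType) (d : nat) (X Y Z : 'M[F]_d) :
  \tr (X *m Y *m Z) =
  \sum_(k : 'I_d * 'I_d) \sum_(l : 'I_d * 'I_d) \sum_(m : 'I_d * 'I_d)
    X k.1 k.2 * Y l.1 l.2 * Z m.1 m.2
      * ((k.1 == m.2)%:R * (k.2 == l.1)%:R * (l.2 == m.1)%:R).
Proof.
transitivity (\sum_a \sum_b \sum_c X a b * Y b c * Z c a).
  rewrite /mxtrace; apply: eq_bigr => a _; rewrite mxE exchange_big.
  by apply: eq_bigr => c _; rewrite mxE big_distrl.
rewrite pair_big; apply: eq_bigr => -[a b] _ /=.
transitivity (\sum_b' \sum_c
    X a b * Y b' c * Z c a * (b == b')%:R).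
  rewrite exchange_big; apply: eq_bigr => c _ /=.
  by rewrite (sum_mul_delta b (fun b' => X a b * Y b' c * Z c a)).
rewrite pair_big; apply: eq_bigr => -[b' c] _ /=.
transitivity (\sum_c' \sum_a'
    X a b * Y b' c * Z c' a' * (b == b')%:R * (c == c')%:R * (a == a')%:R).
  under eq_bigr do rewrite sum_mul_delta.
  by rewrite sum_mul_delta.
by rewrite pair_big; apply: eq_bigr => -[c' a'] _ /=; ring.
Qed.

(** Pairs in ['I_d * A] index d x d blocks. Filling single blocks with X, Y, Z splits the delta
    identity into one for the inner indices, which sums to the trace, and one for the block
    positions. *)
Lemma mmrank_trace (F : fieldType) (d : nat) (A B C S : finType)
    (u : 'I_d * A -> 'I_d * B -> S -> F) (v : 'I_d * B -> 'I_d * C -> S -> F)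
    (w : 'I_d * C -> 'I_d * A -> S -> F)
    (uvw : forall a b b' c c' a',
      \sum_s u a b s * v b' c s * w c' a' s
      = (a == a')%:R * (b == b')%:R * (c == c')%:R)
    (X Y Z : 'M[F]_d) (a : A) (b b' : B) (c c' : C) (a' : A) :
  \sum_s (\sum_(k : 'I_d * 'I_d) X k.1 k.2 * u (k.1, a) (k.2, b) s) *
         (\sum_(k : 'I_d * 'I_d) Y k.1 k.2 * v (k.1, b') (k.2, c) s) *
         (\sum_(k : 'I_d * 'I_d) Z k.1 k.2 * w (k.1, c') (k.2, a') s)
  = \tr (X *m Y *m Z) * ((a == a')%:R * (b == b')%:R * (c == c')%:R).
Proof.
rewrite mxtrace_mul3 sum_mul3 big_distrl; apply: eq_bigr => k _ /=.
rewrite big_distrl; apply: eq_bigr => l _ /=.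
rewrite big_distrl; apply: eq_bigr => m _ /=.
transitivity (X k.1 k.2 * Y l.1 l.2 * Z m.1 m.2 * \sum_s
  u (k.1, a) (k.2, b) s * v (l.1, b') (l.2, c) s * w (m.1, c') (m.2, a') s).
  by rewrite big_distrr; apply: eq_bigr => s _ /=; ring.
by rewrite uvw !xpair_eqE -!mulnb !natrM; ring.
Qed.

(** Translation by x != 1 fixes no element of [G], so its matrix has zero diagonal. *)
Lemma mxtrace_regular (F : fieldType) (gT : finGroupType) (G : {group gT}) :
  {in G, forall x, \tr (regular_repr F G x) = #|G|%:R * (x == 1%g)%:R}.
Proof.
move=> x Gx; have [-> | ntx] := eqVneq x 1%g.
  by rewrite repr_mx1 mxtrace1 mulr1.
rewrite mulr0 [\tr _]big1 // => i _; rewrite 2!mxE /=.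
rewrite -(inj_eq enum_val_inj) gring_indexK ?groupM ?enum_valP //.
by rewrite eq_mulVg1 mulKg (negbTE ntx).
Qed.

(** The regular representation contains each irreducible as often as its degree, and |G| is
    invertible in [F]. *)
Lemma sum_irr_trace (F : fieldType) (gT : finGroupType) (G : {group gT})
    (sG : irrType F G) :
  ([pchar F]^'.-group G)%g -> group_splitting_field F G ->
  {in G, forall x, \sum_(i : sG)
    (irr_degree i)%:R / #|G|%:R * \tr (irr_repr i x) = (x == 1%g)%:R}.
Proof.
move=> F'G splitG x Gx.
have G0 : #|G|%:R != 0 :> F by rewrite natf_neq0_pchar.
apply: (mulfI G0); rewrite -mxtrace_regular //.
rewrite (mxtrace_regular_pchar sG) // big_distrr; apply: eq_bigr => i _ /=.
rewrite -mulr_natl; field; exact: G0.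
Qed.

(** Conjugation by [x'] turns the product on the left into (x' x^-1) (y y'^-1) (z z'^-1), a product
    of three right quotients. *)
Lemma realizes_eq (gT : finGroupType) (S1 S2 S3 : {set gT}) :
  (forall q1 q2 q3 : gT,
      q1 \in right_quotients S1 -> q2 \in right_quotients S2 ->
      q3 \in right_quotients S3 ->
      (q1 * q2 * q3 = 1)%g -> [/\ q1 = 1%g, q2 = 1%g & q3 = 1%g]) ->
  forall x x' y y' z z', x \in S1 -> x' \in S1 -> y \in S2 -> y' \in S2 ->
    z \in S3 -> z' \in S3 ->
  ((x^-1 * y) * (y'^-1 * z) * (z'^-1 * x') == 1)%g =
    [&& x == x', y == y' & z == z'].
Proof.
move=> H x x' y y' z z' Sx Sx' Sy Sy' Sz Sz'; apply/eqP/idP; last first.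
  case/and3P=> /eqP<- /eqP<- /eqP<-.
  by rewrite !mulgA -(mulgA _ y) mulgV mulg1 -(mulgA _ z) mulgV mulg1 mulVg.
move=> E; have [||||] := H (x' * x^-1)%g (y * y'^-1)%g (z * z'^-1)%g.
- exact: imset2_f.
- exact: imset2_f.
- exact: imset2_f.
- by have := mulgV x'; rewrite -{1}(mulg1 x') -E !mulgA mulgK.
by move=> /divg1_eq<- /divg1_eq-> /divg1_eq->; rewrite !eqxx.
Qed.

(* Fourier inversion [x y z = 1] = sum_i d_i / |G| tr (rho_i (x) rho_i (y)
   rho_i (z)) expresses the structure tensor of the group algebra through the
   matrix multiplications of the dimensions of the representations; the
   triple product property embeds a matrix multiplication into the former via
   (x, y) |-> x^-1 y. *)
Lemma realizes_mmrank (F : fieldType) (gT : finGroupType) (G : {group gT})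
    (sG : irrType F G) (n m p : nat) (A B C : finType) (r : sG -> nat) :
  ([pchar F]^'.-group G)%g -> group_splitting_field F G -> realizes G n m p ->
  (forall i : sG, mmrank_le F ('I_(irr_degree i) * A)%type
     ('I_(irr_degree i) * B)%type ('I_(irr_degree i) * C)%type (r i)) ->
  mmrank_le F ('I_n * A)%type ('I_m * B)%type ('I_p * C)%type (\sum_i r i)%N.
Proof.
move=> F'G splitG [S1 [S2 [S3 [[/fintype.subsetP S1G /fintype.subsetP S2G
  /fintype.subsetP S3G] [[<- <- <-] tpp]]]]] rk.
have DS i := cid (rk i); pose S i := projT1 (DS i).
have Du i := cid (projT2 (DS i)); pose u i := projT1 (Du i).
have Dv i := cid (projT2 (Du i)); pose v i := projT1 (Dv i).
have Dw i := cid (projT2 (Dv i)); pose w i := projT1 (Dw i).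
have cS i : (#|S i| <= r i)%N := (projT2 (Dw i)).1.
have uvw i := (projT2 (Dw i)).2.
pose rho (i : sG) (s t : gT) := irr_repr i (s^-1 * t)%g.
(* The algorithms for all [i] are placed side by side; the Fourier weight d_i / |G| goes into the
   third family of coefficients. *)
exists {i : sG & S i},
  (fun x y s => \sum_(k : 'I_(irr_degree (tag s)) * 'I_(irr_degree (tag s)))
    rho (tag s) (enum_val x.1) (enum_val y.1) k.1 k.2
      * u (tag s) (k.1, x.2) (k.2, y.2) (tagged s)),
  (fun x y s => \sum_(k : 'I_(irr_degree (tag s)) * 'I_(irr_degree (tag s)))
    rho (tag s) (enum_val x.1) (enum_val y.1) k.1 k.2
      * v (tag s) (k.1, x.2) (k.2, y.2) (tagged s)),
  (fun x y s => (irr_degree (tag s))%:R / #|G|%:R *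
   \sum_(k : 'I_(irr_degree (tag s)) * 'I_(irr_degree (tag s)))
    rho (tag s) (enum_val x.1) (enum_val y.1) k.1 k.2
      * w (tag s) (k.1, x.2) (k.2, y.2) (tagged s)); split.
  by rewrite card_tagged sumnE big_map big_enum /= leq_sum.
move=> [x a] [y b] [y' b'] [z c] [z' c'] [x' a'] /=.
have [X X'] := (enum_valP x, enum_valP x').
have [Y Y'] := (enum_valP y, enum_valP y').
have [Z Z'] := (enum_valP z, enum_valP z').
pose g1 := ((enum_val x)^-1 * enum_val y)%g.
pose g2 := ((enum_val y')^-1 * enum_val z)%g.
pose g3 := ((enum_val z')^-1 * enum_val x')%g.
have Gg1 : g1 \in G := groupM (groupVr (S1G _ X)) (S2G _ Y).
have Gg2 : g2 \in G := groupM (groupVr (S2G _ Y')) (S3G _ Z).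
have Gg3 : g3 \in G := groupM (groupVr (S3G _ Z')) (S1G _ X').
(* The indicator of g1 g2 g3 = 1 links the two sides: Fourier inversion gives it on the left, the
   triple product property on the right. *)
transitivity ((g1 * g2 * g3 == 1)%g%:R *
  ((a == a')%:R * (b == b')%:R * (c == c')%:R) : F); last first.
  rewrite (realizes_eq tpp) // !(inj_eq enum_val_inj) !xpair_eqE.
  by rewrite -!mulnb !natrM; ring.
have Gg := groupM (groupM Gg1 Gg2) Gg3.
rewrite -(sum_irr_trace sG F'G splitG Gg) big_distrl /=.
rewrite [RHS](eq_bigr (fun i : sG => \sum_(s : S i)
   (irr_degree i)%:R / #|G|%:R * ((\sum_(k : 'I_(irr_degree i) * 'I_(irr_degree i))
      irr_repr i g1 k.1 k.2 * u i (k.1, a) (k.2, b) s) *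
    (\sum_(k : 'I_(irr_degree i) * 'I_(irr_degree i))
      irr_repr i g2 k.1 k.2 * v i (k.1, b') (k.2, c) s) *
    (\sum_(k : 'I_(irr_degree i) * 'I_(irr_degree i))
      irr_repr i g3 k.1 k.2 * w i (k.1, c') (k.2, a') s)))).
  rewrite sig_big_dep /=; apply: eq_bigr => -[i s] _ /=.
  by rewrite mulrCA !mulrA.
move=> i _; rewrite -big_distrr /= (mmrank_trace (uvw i)) mulrA.
by rewrite (repr_mxM _ (groupM Gg1 Gg2) Gg3) (repr_mxM _ Gg1 Gg2) !mulrA.
Qed.

(** * Arithmetic programs *)

(* [reach X N Y]: starting from the functions in [X], all those in [Y] are
   available after at most [N] operations.  Sets of functions compose better
   than programs, whose registers would have to be renumbered. *)
Inductive reach (F : fieldType) (I : Type) (X : set ((I -> F) -> F)) :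
    nat -> set ((I -> F) -> F) -> Prop :=
| reach_refl : reach X 0 X
| reach_add N Y f g : reach X N Y -> Y f -> Y g ->
    reach X N.+1 ((fun x => f x + g x) |` Y)
| reach_mul N Y f g : reach X N Y -> Y f -> Y g ->
    reach X N.+1 ((fun x => f x * g x) |` Y)
| reach_weak N M Y Z : reach X N Y -> (N <= M)%N -> Z `<=` Y -> reach X M Z.

Definition free_functions (F : fieldType) (I : Type) : set ((I -> F) -> F) :=
  [set f | (exists c, f = cst c) \/ (exists i, f = @^~ i)].

Section Reach.
Context (F : fieldType).

Lemma reach_subset (I : Type) (X X' : set ((I -> F) -> F)) N Y :
  reach X N Y -> X `<=` X' -> reach X' N Y.
Proof.
move=> H XX'; elim: H => [|{}N {}Y f g _ IH Yf Yg|{}N {}Y f g _ IH Yf Yg|{}N M {}Y Z _ IH NM ZY].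
- exact: reach_weak (reach_refl _) (leqnn _) XX'.
- exact: reach_add.
- exact: reach_mul.
exact: reach_weak IH NM ZY.
Qed.

Lemma reach_frame (I : Type) (X W : set ((I -> F) -> F)) N Y :
  reach X N Y -> reach (X `|` W) N (Y `|` W).
Proof.
elim=> [|{}N {}Y f g _ IH Yf Yg|{}N {}Y f g _ IH Yf Yg|{}N M {}Y Z _ IH NM ZY].
- exact: reach_refl.
- by rewrite -setUA; apply: reach_add => //; left.
- by rewrite -setUA; apply: reach_mul => //; left.
by apply: reach_weak IH NM _; apply: setSU.
Qed.

Lemma reach_trans (I : Type) (X Y Z : set ((I -> F) -> F)) N M :
  reach X N Y -> reach Y M Z -> reach X (N + M) Z.
Proof.
move=> XY; elim=> [|{}M {}Z f g _ IH Yf Yg|{}M {}Z f g _ IH Yf Yg|{}M M' {}Z W _ IH MM' WZ].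
- by rewrite addn0.
- by rewrite addnS; apply: reach_add.
- by rewrite addnS; apply: reach_mul.
by apply: reach_weak IH _ WZ; rewrite leq_add2l.
Qed.

Lemma reach_keep (I : Type) (X : set ((I -> F) -> F)) N Y :
  reach X N Y -> reach X N (Y `|` X).
Proof. by move/(reach_frame X); rewrite setUid. Qed.

Lemma reach_union (I : Type) (X Y Z : set ((I -> F) -> F)) N M :
  reach X N Y -> reach X M Z -> reach X (N + M) (Y `|` Z).
Proof.
move=> /reach_keep XY XZ; apply: reach_trans XY _.
by have := reach_frame Y XZ; rewrite (setUC X) (setUC Z).
Qed.

Lemma reach_bigcup (I : Type) (J : finType) (X : set ((I -> F) -> F)) N
    (Y : J -> set ((I -> F) -> F)) :
  (forall j, reach X N (Y j)) -> reach X (#|J| * N) (\bigcup_j Y j).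
Proof.
move=> XY; suff H (s : seq J) : reach X (size s * N) (\bigcup_(j in [set` s]) Y j).
  rewrite cardE; apply: reach_weak (H (enum J)) (leqnn _) _.
  by move=> f [j _ Yf]; exists j => //=; rewrite mem_enum.
elim: s => [|j s IH].
  apply: reach_weak (reach_refl X) _ _ => //.
  by move=> f [].
rewrite /= mulSn; apply: reach_weak (reach_union (XY j) IH) (leqnn _) _.
move=> f [k /=]; rewrite inE => /orP[/eqP->|sk] Yf; first by left.
by right; exists k.
Qed.

(** Each term costs one scalar multiplication and one addition; the sum starts from the free
    constant 0. *)
Lemma reach_linear (I : Type) (J : finType) (X : set ((I -> F) -> F))
    (c : J -> F) (f : J -> (I -> F) -> F) :
  (forall a, X (cst a)) -> (forall j, X (f j)) ->
  reach X (2 * #|J|) [set fun x => \sum_j c j * f j x].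
Proof.
move=> Xc Xf; rewrite cardE.
have -> : (fun x => \sum_j c j * f j x) =
          (fun x => \sum_(j <- enum J) c j * f j x).
  by apply/funext => x; rewrite big_enum.
suff : reach X (2 * size (enum J))
   ((fun x => \sum_(j <- enum J) c j * f j x) |` X).
  by move/reach_weak; apply => // _ ->; left.
elim: (enum J) => [|j s IH].
  apply: reach_weak (reach_refl X) _ _ => //.
  move=> g [->|//]; suff -> : (fun x => \sum_(j <- [::]) c j * f j x) = cst 0.
    exact: Xc.
  by apply/funext => x; rewrite big_nil.
rewrite /= mulnS add2n.
have H := reach_mul IH (or_intror (Xc (c j))) (or_intror (Xf j)).
have {}H := reach_add H (or_introl erefl) (or_intror (or_introl erefl)).
apply: reach_weak H (leqnn _) _.
move=> g [->|Xg]; last by right; right; right.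
by left; apply/funext => x; rewrite big_cons.
Qed.

(** Substitution of computed values for inputs, which is what a recursive call does. *)
Lemma reach_comp (I I' : Type) (phi : (I -> F) -> I' -> F)
    (X : set ((I' -> F) -> F)) N Y :
  reach X N Y -> reach [set f \o phi | f in X] N [set f \o phi | f in Y].
Proof.
elim=> [|{}N {}Y f g _ IH Yf Yg|{}N {}Y f g _ IH Yf Yg|{}N M {}Y Z _ IH NM ZY].
- exact: reach_refl.
- by rewrite image_setU image_set1; apply: (@reach_add _ _ _ _ _ (f \o phi) (g \o phi)) => //; [exists f|exists g].
- by rewrite image_setU image_set1; apply: (@reach_mul _ _ _ _ _ (f \o phi) (g \o phi)) => //; [exists f|exists g].
by apply: reach_weak IH NM _; apply: image_subset.
Qed.

Lemma run_rcons (I : Type) (x : I -> F) (prog : seq (instruction F I)) ins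
    regs regs' v :
  run x regs prog = Some regs' -> eval_instruction x regs' ins = Some v ->
  run x regs (rcons prog ins) = Some (rcons regs' v).
Proof.
elim: prog regs => [|i prog IH] regs /=; first by case=> -> ->.
by case: eval_instruction => // w; apply: IH.
Qed.

Lemma eval_operand_rcons (I : Type) (x : I -> F) regs v o a :
  eval_operand x regs o = Some a -> eval_operand x (rcons regs v) o = Some a.
Proof.
case: o => //= k E; rewrite -cats1 onth_cat -onthTE.
by rewrite E.
Qed.

(** [gs] lists the functions held by the registers; it does not depend on [x], so one operand serves
    every input. *)
Lemma reach_program (I : Type) N (Y : set ((I -> F) -> F)) :
  reach (@free_functions F I) N Y ->
  exists (prog : seq (instruction F I)) (gs : seq ((I -> F) -> F)),
  [/\ (size prog <= N)%N,
     forall x, run x [::] prog = Some [seq g x | g <- gs] &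
     forall f, Y f -> exists o,
       forall x, eval_operand x [seq g x | g <- gs] o = Some (f x)].
Proof.
have step N' Y' f g op (h : (I -> F) -> F) :
    (forall x, eval_op op (f x) (g x) = Some (h x)) -> Y' f -> Y' g ->
  (exists (prog : seq (instruction F I)) (gs : seq ((I -> F) -> F)),
  [/\ (size prog <= N')%N,
     forall x, run x [::] prog = Some [seq g x | g <- gs] &
     forall f, Y' f -> exists o,
       forall x, eval_operand x [seq g x | g <- gs] o = Some (f x)]) ->
  exists (prog : seq (instruction F I)) (gs : seq ((I -> F) -> F)),
  [/\ (size prog <= N'.+1)%N,
     forall x, run x [::] prog = Some [seq g x | g <- gs] &
     forall f, (h |` Y') f -> exists o,
       forall x, eval_operand x [seq g x | g <- gs] o = Some (f x)].
  move=> hop Yf Yg [prog [gs [sz rn ev]]].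
  have [[p1 e1] [p2 e2]] := (ev f Yf, ev g Yg).
  exists (rcons prog (op, p1, p2)), (rcons gs h); split.
  - by rewrite size_rcons.
  - move=> x; rewrite map_rcons; apply: run_rcons (rn x) _.
    by rewrite /= e1 e2 hop.
  move=> k [->|Yk].
    exists (Reg (size gs)) => x.
    by rewrite /= onth_map -cats1 onth_cat ltnn subnn.
  have [p e] := ev k Yk; exists p => x; rewrite map_rcons.
  exact: eval_operand_rcons.
elim=> [|{}N {}Y f g _ IH Yf Yg|{}N {}Y f g _ IH Yf Yg|{}N M {}Y Z _ IH NM ZY].
- exists [::], [::]; split=> // f [[c ->]|[i ->]].
    by exists (Const c).
  by exists (Input i).
- exact: (step _ _ f g OpAdd).
- exact: (step _ _ f g OpMul).
have [prog [gs [sz rn ev]]] := IH.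
exists prog, gs; split=> //; first exact: leq_trans NM.
by move=> f /ZY; apply: ev.
Qed.

End Reach.

(** * Matrix multiplication by recursion on blocks *)

Definition mm_functions (F : fieldType) (A : finType) :
    set ((A * A + A * A -> F) -> F) :=
  [set f | exists a b, f = fun x => \sum_c x (inl (a, c)) * x (inr (c, b))].

Definition mm_reach (F : fieldType) (A : finType) (N : nat) : Prop :=
  reach (@free_functions F (A * A + A * A)%type) N (@mm_functions F A).

(* Smaller matrices are padded with zero rows and columns. *)
Lemma mm_reach_card (F : fieldType) (A B : finType) (N : nat) :
  (#|A| <= #|B|)%N -> mm_reach F B N -> mm_reach F A N.
Proof.
move=> /injection_of_card[f fI] H.
pose ext (M : A * A -> F) (ij : B * B) : F :=
  if [pick p : A * A | (f p.1, f p.2) == ij] is Some p then M p else 0.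
have extE M a b : ext M (f a, f b) = M (a, b).
  rewrite /ext; case: pickP => [[a' b'] /= /eqP[/fI-> /fI->] //|/(_ (a, b))].
  by rewrite eqxx.
have extC M a : a \notin codom f -> forall b, ext M (b, a) = 0.
  move=> fa b; rewrite /ext; case: pickP => // -[a' b'] /= /eqP[_ E].
  by rewrite -E codom_f in fa.
pose phi (x : A * A + A * A -> F) (i : B * B + B * B) : F :=
  match i with inl p => ext (x \o inl) p | inr p => ext (x \o inr) p end.
apply: reach_weak (reach_subset (reach_comp phi H) _) (leqnn _) _.
  (* A padded entry is an input or the constant 0, so padding is free. *)
  have atom (inj : A * A -> A * A + A * A) (ij : B * B) :
      free_functions (fun x : _ -> F => ext (x \o inj) ij).
    rewrite /ext; case: pickP => [p _|_]; last by left; exists 0.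
    by right; exists (inj p).
  move=> _ [g [[c ->]|[[p|p] ->]] <-]; [by left; exists c|exact: (atom inl)|exact: (atom inr)].
move=> _ [a [b ->]].
exists (fun x => \sum_c x (inl (f a, c)) * x (inr (c, f b))).
  by exists (f a), (f b).
apply/funext => x /=; rewrite (bigID (mem (codom f))) /= addrC big1 ?add0r.
  rewrite -big_uniq /=; last by rewrite map_inj_uniq ?enum_uniq.
  by rewrite big_map big_enum /=; apply: eq_bigr => c _; rewrite !extE.
by move=> c fc; rewrite extC // mul0r.
Qed.

Lemma mm_reach_unit (F : fieldType) : mm_reach F unit 1.
Proof.
pose f (x : unit * unit + unit * unit -> F) := x (inl (tt, tt)).
pose g (x : unit * unit + unit * unit -> F) := x (inr (tt, tt)).
apply: reach_weak (@reach_mul _ _ _ _ _ f g (reach_refl _) _ _) (leqnn _) _.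
- by right; exists (inl (tt, tt)).
- by right; exists (inr (tt, tt)).
move=> _ [[] [[] ->]]; left; apply/funext => x.
by rewrite (big_pred1 tt) // => -[].
Qed.

Lemma sum_row_col (F : fieldType) (B : finType) (X Y : B -> B -> F) (i j : B) :
  \sum_b X i b * Y b j =
  \sum_(p : B * B) \sum_(q : B * B)
    X p.1 p.2 * Y q.1 q.2
      * ((p.1 == i)%:R * (p.2 == q.1)%:R * (q.2 == j)%:R).
Proof.
transitivity (\sum_p1 \sum_p2 X p1 p2 * Y p2 j * (i == p1)%:R).
  rewrite exchange_big; apply: eq_bigr => p2 _ /=.
  by rewrite (sum_mul_delta i (fun p1 => X p1 p2 * Y p2 j)).
rewrite pair_big; apply: eq_bigr => -[p1 p2] _ /=.
transitivity (\sum_q1 \sum_q2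
    X p1 p2 * Y q1 q2 * (i == p1)%:R * (p2 == q1)%:R * (j == q2)%:R).
  under eq_bigr do rewrite sum_mul_delta.
  by rewrite sum_mul_delta.
rewrite pair_big; apply: eq_bigr => -[q1 q2] _ /=.
by rewrite [p1 == i]eq_sym [q2 == j]eq_sym; ring.
Qed.

(** A matrix over [A * B] is a B x B matrix of A x A blocks. Each of the r products becomes a block
    product of cost [N]. The linear combinations cost 2 r |A|^2 |B|^2 operations for each of the
    left factors, the right factors and the outputs, whence the 6. *)
Lemma mm_reach_prod (F : fieldType) (A B : finType) (N r : nat) :
  mm_reach F A N -> mmrank_le F B B B r ->
  mm_reach F (A * B)%type (r * N + 6 * r * (#|A| ^ 2 * #|B| ^ 2)).
Proof.
move=> HA [S [u [v [w [cS H]]]]].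
pose I := ((A * B) * (A * B) + (A * B) * (A * B))%type.
pose X := @free_functions F I.
have Xc a : X (cst a) by left; exists a.
pose U s (a a' : A) (x : I -> F) :=
  \sum_(p : B * B) u p.1 p.2 s * x (inl ((a, p.1), (a', p.2))).
pose V s (a a' : A) (x : I -> F) :=
  \sum_(p : B * B) v p.1 p.2 s * x (inr ((a, p.1), (a', p.2))).
pose P s (a a' : A) (x : I -> F) := \sum_c U s a c x * V s c a' x.
(* The third family is dual to the output, so entry (i, j) uses the coefficient of [w] at (j, i). *)
pose O (a : A * B) (a' : A * B) (x : I -> F) :=
  \sum_s w a'.2 a.2 s * P s a.1 a'.1 x.
pose UV := \bigcup_(t : S * (A * A))
  ([set U t.1 t.2.1 t.2.2] `|` [set V t.1 t.2.1 t.2.2]).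
have reachUV : reach X (#|S| * #|A| ^ 2 * (4 * #|B| ^ 2)) (UV `|` X).
  apply: reach_keep; rewrite -!mulnn -!card_prod.
  apply: reach_weak (reach_bigcup _) _ (@subset_refl _ _) => [[s [a a']] /=|].
    apply: reach_union.
      by apply: reach_linear => // p; right; exists (inl ((a, p.1), (a', p.2))).
    by apply: reach_linear => // p; right; exists (inr ((a, p.1), (a', p.2))).
  by rewrite !card_prod -mulnDl.
pose PP := \bigcup_(s : S) [set P s a a' | a in setT & a' in setT].
have reachP : reach (UV `|` X) (#|S| * N) (PP `|` (UV `|` X)).
  apply: reach_keep; apply: reach_bigcup => s.
  pose phi (x : I -> F) (i : A * A + A * A) : F :=
    match i with inl p => U s p.1 p.2 x | inr p => V s p.1 p.2 x end.
  apply: reach_weak (reach_subset (reach_comp phi HA) _) (leqnn _) _.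
    move=> _ [f [[c ->]|[[p|p] ->]] <-].
    - by right; apply: Xc.
    - by left; exists (s, p) => //; left.
    - by left; exists (s, p) => //; right.
  move=> _ [a _ [a' _ <-]].
  by exists (fun x => \sum_c x (inl (a, c)) * x (inr (c, a'))); first by exists a, a'.
have reachO : reach (PP `|` (UV `|` X)) (#|A| ^ 2 * #|B| ^ 2 * (2 * #|S|))
    (\bigcup_(t : (A * B) * (A * B)) [set O t.1 t.2]).
  rewrite -expnMn -card_prod -mulnn -card_prod.
  apply: reach_bigcup => -[a a'] /=; apply: reach_linear.
    by move=> c; right; right; apply: Xc.
  by move=> s; left; exists s => //; exists a.1 => //; exists a'.1.
apply: reach_weak (reach_trans reachUV (reach_trans reachP reachO)) _ _.
  have := leq_mul cS (leqnn N); have := leq_mul cS (leqnn (#|A| ^ 2 * #|B| ^ 2)%N).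
  move: (#|A| ^ 2)%N (#|B| ^ 2)%N #|S|  => x y z; nia.
move=> _ [a [a' ->]]; exists (a, a') => //=; apply/funext => x.
transitivity (\sum_c \sum_(p : B * B) \sum_(q : B * B)
   x (inl ((a.1, p.1), (c, p.2))) * x (inr ((c, q.1), (a'.1, q.2))) *
   ((p.1 == a.2)%:R * (p.2 == q.1)%:R * (q.2 == a'.2)%:R)).
  transitivity (\sum_c \sum_b x (inl (a, (c, b))) * x (inr ((c, b), a'))).
    by rewrite pair_big; apply: eq_bigr => -[c b].
  apply: eq_bigr => c _ /=.
  rewrite -(sum_row_col (fun b b' => x (inl ((a.1, b), (c, b'))))
                        (fun b b' => x (inr ((c, b), (a'.1, b'))))).
  by apply: eq_bigr => b _; rewrite -!surjective_pairing.
symmetry; rewrite /O; transitivity (\sum_s \sum_c \sum_(p : B * B) \sum_(q : B * B)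
      w a'.2 a.2 s * ((u p.1 p.2 s * x (inl ((a.1, p.1), (c, p.2)))) *
                      (v q.1 q.2 s * x (inr ((c, q.1), (a'.1, q.2)))))).
    apply: eq_bigr => s _; rewrite big_distrr; apply: eq_bigr => c _ /=.
    rewrite big_distrlr big_distrr; apply: eq_bigr => p _ /=.
    by rewrite big_distrr.
  rewrite exchange_big; apply: eq_bigr => c _ /=.
  rewrite exchange_big; apply: eq_bigr => p _ /=.
  rewrite exchange_big; apply: eq_bigr => q _ /=.
  rewrite -H big_distrr; apply: eq_bigr => s _ /=; ring.
Qed.

(** * Exponents *)

Lemma mm_reach_ops (F : fieldType) (n N : nat) :
  mm_reach F 'I_n N -> exists2 M, matmul_in_ops F n M & (M <= N)%N.
Proof.
move=> /reach_program[prog [gs [sz rn ev]]]; exists (size prog) => //.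
have H (ij : 'I_n * 'I_n) : exists o, forall x,
    eval_operand x [seq g x | g <- gs] o =
    Some (\sum_c x (inl (ij.1, c)) * x (inr (c, ij.2))).
  by apply: (ev (fun x => _)); exists ij.1, ij.2.
have [out outE] := choice H.
exists prog, (fun i j => out (i, j)); split=> // A B.
exists [seq g (matmul_entries A B) | g <- gs]; split=> // i j.
by rewrite outE mxE.
Qed.

Lemma size_run (F : fieldType) (I : Type) (x : I -> F) prog regs regs' :
  run x regs prog = Some regs' -> size regs' = (size regs + size prog)%N.
Proof.
elim: prog regs => [|i prog IH] regs /=; first by case=> <-; rewrite addn0.
by case: eval_instruction => // v /IH ->; rewrite size_rcons addSnnS.
Qed.

(* No entry of the product is a constant or an input, and no two coincide, so
   each of them occupies a result register of its own. *)
Lemma matmul_in_ops_ge (F : fieldType) (n N : nat) :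
  matmul_in_ops F n N -> (n ^ 2 <= N)%N.
Proof.
move=> [prog [out [sz cmp]]].
have delta i j : delta_mx i i *m delta_mx i j = delta_mx i j :> 'M[F]_n.
  by rewrite mul_delta_mx.
have one0 : 1 <> 0 :> F by apply/eqP; exact: oner_neq0.
have H (ij : 'I_n * 'I_n) : exists k : 'I_N, out ij.1 ij.2 = Reg k.
  case: ij => i j /=.
  case E : (out i j) => [c|[ab|ab]|k].
  - have [? [_ /(_ i j)]] := cmp 0 0; rewrite E /= mul0mx mxE => -[c0].
    have [? [_ /(_ i j)]] := cmp (delta_mx i i) (delta_mx i j).
    by rewrite E /= c0 delta mxE !eqxx => -[] /esym.
  - have [? [_ /(_ i j)]] := cmp (const_mx 1) 0.
    by rewrite E /= mulmx0 !mxE => -[].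
  - have [? [_ /(_ i j)]] := cmp 0 (const_mx 1).
    by rewrite E /= mul0mx !mxE => -[].
  have [regs [rn /(_ i j)]] := cmp 0 0; rewrite E /= => Ek.
  have kN : (k < N)%N.
    by have := size_run rn; rewrite add0n sz => <-; rewrite -onthTE Ek.
  by exists (Ordinal kN).
have [f fE] := choice H.
have fI : injective f.
  move=> [i j] [i' j'] eqf; have := fE (i, j); rewrite eqf -fE /= => E.
  have [regs [_ ev]] := cmp (delta_mx i i) (delta_mx i j).
  have := ev i j; rewrite E ev delta !mxE !eqxx /= => -[].
  by case: (eqVneq i' i) => [->|_]; case: (eqVneq j' j) => [->|_] //= /esym.
by have := leq_card f fI; rewrite card_prod !card_ord mulnn.
Qed.

Lemma mm_reach_pow (F : fieldType) (q r : nat) :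
  (q ^ 2 < r)%N -> mmrank_le F 'I_q 'I_q 'I_q r ->
  forall k, mm_reach F 'I_(q ^ k) ((6 * r * q ^ 2).+1 * r ^ k).
Proof.
move=> qr rk k; set c := (6 * r * q ^ 2)%N.
(* The extra term c (q^k)^2 strengthens the induction so that it absorbs the linear work of the next
   level; this needs q^2 + 1 <= r. *)
suff [M HM MC] : exists2 M, mm_reach F 'I_(q ^ k) M &
    (M + c * (q ^ k) ^ 2 <= c.+1 * r ^ k)%N.
  by apply: reach_weak HM _ (@subset_refl _ _); apply: leq_trans MC; apply: leq_addr.
elim: k => [|k [M HM MC]].
  exists 1%N; last by rewrite !expn0 exp1n !muln1 add1n.
  by apply: mm_reach_card (mm_reach_unit F); rewrite card_ord card_unit.
exists (r * M + 6 * r * ((q ^ k) ^ 2 * q ^ 2))%N.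
  have := mm_reach_prod HM rk; rewrite !card_ord.
  by apply: mm_reach_card; rewrite card_prod !card_ord expnSr.
have -> : (6 * r * ((q ^ k) ^ 2 * q ^ 2) = c * (q ^ k) ^ 2)%N.
  by rewrite /c; ring.
have -> : ((q ^ k.+1) ^ 2 = (q ^ k) ^ 2 * q ^ 2)%N by rewrite (expnSr q k) expnMn.
rewrite (expnS r k); move: qr MC; set X := ((q ^ k) ^ 2)%N; set Y := (q ^ 2)%N.
set Z := (r ^ k)%N => qr MC.
apply: (@leq_trans (r * (M + c * X))); last first.
  by rewrite [leqRHS]mulnCA leq_mul2l MC orbT.
rewrite mulnDr -addnA leq_add2l.
rewrite (_ : c * X + c * (X * Y) = Y.+1 * (c * X))%N; last by ring.
by rewrite leq_mul2r qr orbT.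
Qed.

Lemma powR_log (R : realType) (q : nat) (s : R) :
  (1 < q)%N -> 0 < s -> q%:R `^ (ln s / ln q%:R) = s.
Proof.
move=> q1 s0; rewrite /powR pnatr_eq0 gtn_eqF ?(ltnW q1) // divfK ?lnK //.
by rewrite gt_eqF // ln_gt0 // ltr1n.
Qed.

(** For q^k <= n < q^(k+1), monotonicity passes to size q^(k+1) at the loss of a factor [s]. [P] is
    abstract because both ranks and operation counts are bounded this way. *)
Lemma geometric_exponent (R : realType) (P : nat -> nat -> Prop) (q : nat)
    (s C : R) :
  (forall n n' r, (n <= n')%N -> P n' r -> P n r) ->
  (1 < q)%N -> 1 <= s -> 0 <= C ->
  (forall k, exists2 r, P (q ^ k)%N r & r%:R <= C * s ^+ k) ->
  exists K, forall n, (0 < n)%N ->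
    exists2 r, P n r & r%:R <= K * n%:R `^ (ln s / ln q%:R).
Proof.
move=> mono q1 s1 C0 H; exists (C * s) => n n0.
have /andP[qn nq] := trunc_log_bounds q1 n0.
set k := trunc_log q n in qn nq; have [r Pr rC] := H k.+1.
exists r; first exact: mono (ltnW nq) Pr.
apply: (le_trans rC); rewrite exprS mulrA ler_wpM2l ?mulr_ge0 //.
  exact: le_trans s1.
have s0 : 0 < s := lt_le_trans ltr01 s1.
have lnq : 0 < ln q%:R :> R by rewrite ln_gt0 // ltr1n.
have e0 : 0 <= ln s / ln q%:R by apply: divr_ge0 (ln_ge0 s1) (ltW lnq).
apply: (@le_trans _ _ ((q ^ k)%N%:R `^ (ln s / ln q%:R))).
  rewrite natrX -(powR_mulrn k (ler0n R q)) -powRrM mulrC powRrM.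
  by rewrite powR_log // powR_mulrn // ltW.
by apply: ge0_ler_powR; rewrite ?nnegrE ?ler0n ?ler_nat.
Qed.

Definition rank_exponent (R : realType) (F : fieldType) (t : R) : Prop :=
  exists C : R, forall n, (0 < n)%N ->
    exists2 r, mmrank_le F 'I_n 'I_n 'I_n r & r%:R <= C * n%:R `^ t.

Lemma rank_exponent_le (R : realType) (F : fieldType) (t t' : R) :
  t <= t' -> rank_exponent F t -> rank_exponent F t'.
Proof.
move=> tt' [C H]; exists C => n n0; have [r rk rC] := H n n0.
have C0 : 0 <= C.
  have [r1 _] := H 1%N isT; rewrite powR1 mulr1; apply: le_trans; exact: ler0n.
exists r => //; apply: le_trans rC _; rewrite ler_wpM2l //.
by apply: ler_powR => //; rewrite ler1n.
Qed.

Lemma rank_exponent3 (R : realType) (F : fieldType) :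
  rank_exponent F (3 : R).
Proof.
exists 1 => n n0; exists (n * n * n)%N.
  by have := mmrank_le_trivial F 'I_n 'I_n 'I_n; rewrite !card_ord.
by rewrite mul1r powR_mulrn ?ler0n // !natrM !exprS expr0 mulr1 mulrA.
Qed.

Lemma powR_unbounded (R : realType) (K eps : R) :
  0 < eps -> exists2 q : nat, (1 < q)%N & K <= q%:R `^ eps.
Proof.
move=> eps0; exists (Num.bound (`|K| `^ eps^-1)).+2 => //.
apply: le_trans (ler_norm K) _.
rewrite [leLHS](_ : _ = (`|K| `^ eps^-1) `^ eps); last first.
  by rewrite -powRrM mulVf ?powRr1 // gt_eqF.
apply: ge0_ler_powR; rewrite ?nnegrE ?powR_ge0 ?ler0n ?(ltW eps0) //.
apply: le_trans (ltW (archi_boundP (powR_ge0 _ _))) _.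
by rewrite ler_nat ltnW // ltnW.
Qed.

Lemma rank_exponent_matmul (R : realType) (F : fieldType) (t eps : R) :
  2 <= t -> 0 < eps -> rank_exponent F t -> matmul_in_power F (t + eps).
Proof.
move=> t2 eps0 [C H].
(* A block size with q^eps >= C + 2 absorbs the constant [C] and the q^2 + 1 added to the rank
   below, which secures q^2 < r. *)
have [q q1 qC] := powR_unbounded (C + 2) eps0.
have [r0 rk r0C] := H q (ltnW q1).
pose r := (r0 + (q ^ 2).+1)%N.
have {}rk : mmrank_le F 'I_q 'I_q 'I_q r.
  by apply: mmrank_le_card rk => //; apply: leq_addr.
have qr : (q ^ 2 < r)%N by apply: leq_addl.
pose s : R := q%:R `^ (t + eps).
have q0 : 0 < q%:R :> R by rewrite ltr0n ltnW.
have rs : r%:R <= s.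
  have q2t : q%:R ^+ 2 <= q%:R `^ t :> R.
    by rewrite -powR_mulrn ?ler0n // ler_powR // ler1n ltnW.
  have q1t : 1 <= q%:R `^ t :> R.
    by rewrite -[leLHS](powRr0 q%:R) ler_powR ?ler1n ?(ltnW q1) // (le_trans _ t2).
  rewrite /s powRD; last by rewrite (gt_eqF q0) implybT.
  rewrite /r natrD -natr1 natrX.
  have := ler_wpM2l (powR_ge0 q%:R t) qC; nra.
have s1 : 1 <= s by apply: le_trans rs; rewrite ler1n; apply: leq_ltn_trans qr.
have [||K HK] := @geometric_exponent R (fun n => mm_reach F 'I_n) q s
  (6 * r * q ^ 2).+1%:R _ q1 s1 (ler0n _ _).
- by move=> n n' M nn'; apply: mm_reach_card; rewrite !card_ord.
- move=> k; exists ((6 * r * q ^ 2).+1 * r ^ k)%N; first exact: mm_reach_pow.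
  rewrite natrM natrX ler_wpM2l ?ler0n //.
  by apply: lerXn2r; rewrite ?nnegrE ?ler0n ?powR_ge0.
exists K => n n0; have [M HM MK] := HK n n0.
have [N HN NM] := mm_reach_ops HM; exists N; split=> //.
apply: le_trans (_ : M%:R <= _); first by rewrite ler_nat.
by rewrite /s ln_powR mulfK // in MK; rewrite gt_eqF // ln_gt0 // ltr1n.
Qed.

(** * Rank bounds from character degrees *)

Section Degrees.
Context (R : realType) (gT : finGroupType) (G : {group gT}).
Local Notation C := (complex R).

Let F'G := complex_pchar_group R G.

Let splitG : group_splitting_field C G.
Proof. exact: group_closure_closed_field. Qed.

Let sG := DecSocleType (regular_repr C G).

Lemma irr_degree_le_max (i : sG) :
  (irr_degree i <= max_character_degree R G)%N.
Proof.
by apply: (max_character_degreeP R G).2; exists (irr_repr i); apply: socle_irr.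
Qed.

(** The squares of the degrees sum to |G|, and the trivial representation adds 1 to the square of
    the largest one. *)
Lemma max_degree_sqr_lt :
  (1 < max_character_degree R G)%N -> (max_character_degree R G ^ 2 < #|G|)%N.
Proof.
have [[rG irrG] _] := max_character_degreeP R G.
have [f def_d _ _] := rsim_irr_comp_pchar sG F'G irrG.
set i := irr_comp sG rG in f def_d.
move: def_d; rewrite -[irr_degree _]/(irr_degree i) => def_d D1.
rewrite -(sum_irr_degree_pchar sG F'G splitG) (bigD1 i) //= -def_d.
rewrite -[ltnLHS]addn0 ltn_add2l (bigD1 (principal_comp sG)) /=.
  by rewrite degree_irr1.
by apply: contraTneq D1 => E; rewrite def_d -E degree_irr1.
Qed.

(** The free factor [N] carries the induction: one use of the group reduces exponent l + 1 with
    factor N to exponent l with factors d_i N. *)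
Lemma realizes_mmrank_pow (n m p : nat) (t K : R) :
  realizes G n m p ->
  (forall N, (0 < N)%N ->
    exists2 r, mmrank_le C 'I_N 'I_N 'I_N r & r%:R <= K * N%:R `^ t) ->
  forall l N, (0 < N)%N ->
    exists2 r, mmrank_le C 'I_(n ^ l * N) 'I_(m ^ l * N) 'I_(p ^ l * N) r &
      r%:R <= K * N%:R `^ t * (\sum_(i : sG) (irr_degree i)%:R `^ t) ^+ l.
Proof.
move=> nmp H; elim=> [|l IH] N N0.
  by have [r rk rK] := H N N0; exists r; rewrite ?mul1n // expr0 mulr1.
have /choice[r rH] (i : sG) : exists r : nat,
    mmrank_le C ('I_(irr_degree i) * 'I_(n ^ l * N))%type
      ('I_(irr_degree i) * 'I_(m ^ l * N))%type
      ('I_(irr_degree i) * 'I_(p ^ l * N))%type r /\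
    r%:R <= K * (irr_degree i * N)%N%:R `^ t *
             (\sum_(i : sG) (irr_degree i)%:R `^ t) ^+ l.
  have iN : (0 < irr_degree i * N)%N by rewrite muln_gt0 irr_degree_gt0.
  have [r rk rK] := IH _ iN; exists r; split=> //.
  by apply: mmrank_le_card rk; rewrite // !card_prod !card_ord mulnCA.
exists (\sum_i r i)%N.
  have := realizes_mmrank F'G splitG nmp (fun i => (rH i).1).
  by apply: mmrank_le_card; rewrite // !card_prod !card_ord expnS mulnA.
rewrite natr_sum exprSr mulrA big_distrr /=; apply: ler_sum => i _.
apply: le_trans (rH i).2 _; rewrite natrM powRM ?ler0n //.
by rewrite le_eqVlt; apply/orP; left; apply/eqP; ring.
Qed.

(** Write d^t = d^(t-2) d^2, bound the first factor by D^(t-2), and sum the squares to |G|. *)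
Lemma sum_irr_degree_powR (D : nat) (t : R) :
  2 <= t -> (forall i : sG, (irr_degree i <= D)%N) ->
  \sum_(i : sG) (irr_degree i)%:R `^ t <= D%:R `^ (t - 2) * #|G|%:R.
Proof.
move=> t2 degD; rewrite -(sum_irr_degree_pchar sG F'G splitG) natr_sum.
rewrite big_distrr /=; apply: ler_sum => i _.
have d0 : 0 < (irr_degree i)%:R :> R by rewrite ltr0n irr_degree_gt0.
have -> : (irr_degree i)%:R `^ t =
    (irr_degree i)%:R `^ (t - 2) * (irr_degree i)%:R `^ 2 :> R.
  by rewrite -powRD ?subrK // (gt_eqF d0) implybT.
rewrite natrX (powR_mulrn 2 (ltW d0)) ler_wpM2r ?exprn_ge0 ?(ltW d0) //.
by apply: ge0_ler_powR; rewrite ?nnegrE ?ler0n ?ler_nat ?subr_ge0.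
Qed.

(** With s = D^(t-2) |G|, symmetrizing the l-th power gives squares of size (n m p)^l and rank at
    most (K s^l)^3, hence exponent 3 ln s / ln (n m p). *)
Lemma rank_exponent_realizes (n m p D : nat) (t : R) :
  realizes G n m p -> (1 < n * m * p)%N -> 2 <= t ->
  (forall i : sG, (irr_degree i <= D)%N) -> rank_exponent C t ->
  rank_exponent C
    (3 * ((t - 2) * ln D%:R + ln #|G|%:R) / ln (n * m * p)%N%:R).
Proof.
move=> nmp q1 t2 degD [K H].
have D0 : (0 < D)%N.
  by apply: leq_trans (degD (principal_comp sG)); rewrite irr_degree_gt0.
have K0 : 0 <= K.
  have [r1 _] := H 1%N isT; rewrite powR1 mulr1; apply: le_trans; exact: ler0n.
pose s : R := D%:R `^ (t - 2) * #|G|%:R.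
have D1 : 1 <= D%:R `^ (t - 2) :> R.
  rewrite -[leLHS](powRr0 D%:R) ler_powR ?ler1n ?subr_ge0 //.
have s1 : 1 <= s by rewrite mulr_ege1 // ler1n cardG_gt0.
have s0 : 0 <= s := le_trans ler01 s1.
have [n1 n2 r nn'||||k|K' HK'] := @geometric_exponent R
    (fun n r => mmrank_le C 'I_n 'I_n 'I_n r) (n * m * p) (s ^+ 3) (K ^+ 3).
- by apply: mmrank_le_card; rewrite ?card_ord.
- by [].
- exact: exprn_ege1.
- exact: exprn_ge0.
- have [r rk rK] := realizes_mmrank_pow nmp H k (ltn0Sn 0).
  exists (r ^ 3)%N.
    have := mmrank_le_symmetrize rk; rewrite !muln1 -!expnMn.
    exact.
  rewrite natrX -exprM mulnC exprM -exprMn.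
  apply: lerXn2r; rewrite ?nnegrE ?ler0n ?mulr_ge0 ?exprn_ge0 //.
  apply: le_trans rK _; rewrite powR1 mulr1 ler_wpM2l //.
  apply: lerXn2r; rewrite ?nnegrE ?sum_irr_degree_powR //.
  by apply: sumr_ge0 => i _; apply: powR_ge0.
exists K' => N N0; have [r rk rK] := HK' N N0; exists r => //.
rewrite lnXn ?(lt_le_trans ltr01) // lnM ?posrE ?powR_gt0 ?ltr0n // ln_powR in rK.
by rewrite mulr_natl.
Qed.

End Degrees.

(** * From rank exponents to omega *)

Lemma matmul_exponent_eq2 (R : realType) :
  (forall eps : R, 0 < eps -> rank_exponent (complex R) (2 + eps)) ->
  matmul_exponent R = 2.
Proof.
move=> H; rewrite /matmul_exponent; set E := (X in inf X).
have lb2 : lbound E 2.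
  move=> w /= Ew; rewrite leNgt; apply/negP => w2.
  (* Then w + 2 eps = 2, so n^2 operations exceed K n^(w + eps) once n^eps >= K + 1. *)
  pose eps := (2 - w) / 2; have eps0 : 0 < eps by rewrite divr_gt0 ?subr_gt0.
  have [K HK] := Ew _ eps0.
  have [q q1 qK] := powR_unbounded (K + 1) eps0.
  have [N [/matmul_in_ops_ge qN NK]] := HK q (ltnW q1).
  have q0 : 0 < q%:R :> R by rewrite ltr0n ltnW.
  have : q%:R `^ (w + eps) * q%:R `^ eps <= K * q%:R `^ (w + eps).
    rewrite -powRD; last by rewrite (gt_eqF q0) implybT.
    apply: le_trans NK; rewrite (_ : _ + _ = 2); last by rewrite /eps; field.
    by rewrite powR_mulrn ?ler0n // -natrX ler_nat.
  have := powR_gt0 (w + eps) q0; nra.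
apply/le_anti/andP; split.
  apply: ge_inf; first by exists 2.
  move=> eps eps0; rewrite [eps]splitr addrA.
  have eps20 : 0 < eps / 2 by rewrite divr_gt0.
  by apply: rank_exponent_matmul => //; [rewrite lerDl ltW | exact: H].
(* The schoolbook exponent 3 shows that the set is nonempty. *)
apply: lb_le_inf lb2; exists 3 => eps eps0.
apply: rank_exponent_matmul => //; last exact: rank_exponent3.
by rewrite ler_nat.
Qed.

(** * The improvement map on rank exponents *)

Lemma pseudo_exponent_realizes (R : realType) (gT : finGroupType)
    (G : {group gT}) : pseudo_exponent R G < 3 ->
  exists n m p, [/\ realizes G n m p, (1 < n * m * p)%N &
    pseudo_exponent R G = 3 * ln #|G|%:R / ln (n * m * p)%N%:R].
Proof.
(* The trivial group has pseudo-exponent 3 by convention, which the hypothesis excludes. *)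
have [G1|G1 _] := eqVneq #|G| 1%N.
  by rewrite /pseudo_exponent G1 eqxx ltxx.
have [[n [m [p [[n0 m0 p0] [nmp1 [nmp ->]]]]]] _] := pseudo_exponent_min R G1.
exists n, m, p; split=> //; rewrite ltn_neqAle eq_sym !muln_gt0 n0 m0 p0 !andbT.
apply/eqP => E; apply: nmp1; move: E => /eqP.
by rewrite !muln_eq1 => /andP[/andP[/eqP-> /eqP->] /eqP->].
Qed.

(* [kappa] is 1 / gamma. *)
Lemma rank_exponent_step (R : realType) (gT : finGroupType) (G : {group gT})
    (eps : R) :
  0 <= eps -> pseudo_exponent R G < 3 ->
  (`|(pseudo_exponent R G - 2)%:E| <= eps%:E * `|gamma R G - 2%:E|)%E ->
  exists kappa : R,
  [/\ 0 <= kappa, 2 * kappa < 1,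
     kappa * (pseudo_exponent R G - 2) <= eps * (1 - 2 * kappa) &
     forall t, 2 <= t -> rank_exponent (complex R) t ->
       rank_exponent (complex R) (pseudo_exponent R G * (1 + kappa * (t - 2)))].
Proof.
move=> eps0 a3 small; have [n [m [p [nmp q1 aE]]]] := pseudo_exponent_realizes a3.
have step (D : nat) (kappa : R) : kappa * ln #|G|%:R = ln D%:R ->
    (forall i : DecSocleType (regular_repr (complex R) G),
       (irr_degree i <= D)%N) ->
    forall t, 2 <= t -> rank_exponent (complex R) t ->
    rank_exponent (complex R) (pseudo_exponent R G * (1 + kappa * (t - 2))).
  move=> kD degD t t2 /(rank_exponent_realizes nmp q1 t2 degD).
  congr rank_exponent; rewrite aE -kD; ring.
(* For abelian [G], gamma is infinite and all degrees are 1, so kappa = 0. *)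
have [abG|nabG] := boolP (abelian G).
  exists 0; split; rewrite ?mulr0 ?mul0r ?subr0 ?mulr1 //.
  apply: (step 1%N); first by rewrite mul0r ln1.
  move=> i; rewrite irr_degree_abelian //.
  exact: group_closure_closed_field.
have [g [g0 gE gD]] := gammaP R nabG.
set D := max_character_degree R G in gD.
have G1 : (1 < #|G|)%N.
  by rewrite cardG_gt1; apply: contraNneq nabG => ->; apply: abelian1.
have lnG : 0 < ln #|G|%:R :> R by rewrite ln_gt0 // ltr1n.
have kD : g^-1 * ln #|G|%:R = ln D%:R by rewrite -gD ln_powR.
have k0 : 0 < g^-1 by rewrite invr_gt0.
have D1 : (1 < D)%N.
  rewrite ltnNge; apply/negP => D1.
  have : 0 < ln D%:R :> R by rewrite -kD mulr_gt0.
  by case: D D1 {gD kD} => [|[|//]] _; rewrite ?ln1 ?ln0 ?ltxx.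
(* D^2 < |G| means gamma > 2, which also removes the absolute value around gamma - 2. *)
have k1 : 2 * g^-1 < 1.
  rewrite -(ltr_pM2r lnG) mul1r -mulrA kD mulr_natl -lnXn; last first.
    by rewrite ltr0n ltnW.
  rewrite ltr_ln ?posrE ?exprn_gt0 ?ltr0n ?(ltnW D1) ?(ltnW G1) //.
  by rewrite -natrX ltr_nat max_degree_sqr_lt.
exists g^-1; split=> //; first exact: ltW.
  rewrite gE -EFinB !abse_EFin -EFinM lee_fin in small.
  have g2 : 0 <= g - 2.
    by rewrite subr_ge0 -(ler_pM2r k0) mulfV ?gt_eqF // ltW.
  rewrite (ger0_norm g2) in small.
  apply: (@le_trans _ _ (g^-1 * (eps * (g - 2)))).
    by rewrite ler_pM2l //; apply: le_trans (ler_norm _) small.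
  rewrite le_eqVlt; apply/orP; left; apply/eqP; field.
  by rewrite gt_eqF.
apply: (step D) => // i; exact: irr_degree_le_max.
Qed.

(** Here a = alpha - 2 and d is the distance of a fixed point from 2. Every term is compared with c
    = 1 - 2 kappa, which then cancels however small it is. *)
Lemma contraction_bound (R : realType) (a kappa eps d : R) :
  0 <= kappa -> 2 * kappa < 1 -> 0 <= d -> eps <= 4^-1 -> a <= eps ->
  kappa * a <= eps * (1 - 2 * kappa) -> d <= a + (a + 2) * kappa * d ->
  d <= 4 * eps.
Proof.
move=> k0 k1 d0 eps4 aeps ka H.
set c := 1 - 2 * kappa in ka *; have c0 : 0 < c by rewrite /c; lra.
have H1 : d * c <= a + kappa * a * d by rewrite /c; nra.
have H2 : d * c <= a + eps * c * d by nra.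
(* Since a = c a + 2 kappa a, the bounds on a and kappa a contribute eps c and 2 eps c. *)
have H3 : a <= c * (3 * eps) by rewrite /c in ka *; nra.
have H4 : d * (1 - eps) <= 3 * eps.
  by rewrite -(ler_pM2l c0); nra.
nra.
Qed.

Theorem corollary4p3 (R : realType) (gT : nat -> finGroupType)
    (G : forall i : nat, {group gT i})
    (alpha_cvg : (fun i : nat => pseudo_exponent R (G i)) @ \oo --> (2 : R))
    (alpha_little_o : forall eps : R, 0 < eps ->
       \forall i \near \oo,
         (`|(pseudo_exponent R (G i) - 2)%:E|
            <= eps%:E * `|gamma R (G i) - 2%:E|)%E) :
  matmul_exponent R = 2.
Proof.
apply: matmul_exponent_eq2.
pose T := [set t : R | 2 <= t /\ rank_exponent (complex R) t].
have T3 : T 3 by split; [rewrite ler_nat | exact: rank_exponent3].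
have T2 : lbound T 2 by move=> t [].
have Tinf : has_inf T by split; [exists 3 | exists 2].
suff tau2 : inf T <= 2.
  move=> eps eps0; have [t [_ rt] tT] := inf_adherent eps0 Tinf.
  by apply: rank_exponent_le rt; apply/ltW/(lt_le_trans tT); rewrite lerD2r.
rewrite leNgt; apply/negP => tau2; set tau := inf T in tau2.
(* The bound 1/4 is needed for the contraction; (tau - 2) / 5 makes tau - 2 <= 4 eps
   contradictory. *)
pose eps := Num.min 4^-1 ((tau - 2) / 5).
have eps0 : 0 < eps by rewrite lt_min invr_gt0 ltr0n divr_gt0 ?subr_gt0.
have [i [ai small]] : exists i, `|pseudo_exponent R (G i) - 2| <= eps /\
    (`|(pseudo_exponent R (G i) - 2)%:E|
       <= eps%:E * `|gamma R (G i) - 2%:E|)%E.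
  have near1 : \forall i \near \oo, `|pseudo_exponent R (G i) - 2| <= eps.
    by move/cvgrPdistC_le : alpha_cvg; apply.
  have [N _ HN] := filterI near1 (alpha_little_o eps eps0).
  by exists N; apply: HN => /=.
set alpha := pseudo_exponent R (G i) in ai small.
have eps4 : eps <= 4^-1 by rewrite ge_min lexx.
have a2 : alpha - 2 <= eps := le_trans (ler_norm _) ai.
have a2' : 2 - alpha <= eps by rewrite -(distrC 2) in ai; apply: le_trans (ler_norm _) ai.
have a3 : alpha < 3 by move: eps4 a2; lra.
have [kappa [k0 k1 ka step]] := rank_exponent_step (ltW eps0) a3 small.
have {}step t : T t -> tau <= alpha * (1 + kappa * (t - 2)).
  move=> [t2 rt]; set t' := alpha * _.
  (* The new exponent may fall below 2, outside [T]; as tau > 2, the maximum with 2 still yields tau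
     <= t'. *)
  have Tmax : T (Num.max 2 t').
    split; first by rewrite le_max lexx.
    by apply: rank_exponent_le (step t t2 rt); rewrite le_max lexx orbT.
  have := ge_inf (ex_intro _ 2 T2) Tmax.
  by rewrite -/tau le_max leNgt tau2.
have tau_step : tau <= alpha * (1 + kappa * (tau - 2)).
  have [k00|kn0] := eqVneq kappa 0.
    by have := step 3 T3; rewrite k00 !mul0r.
  have kpos : 0 < kappa by rewrite lt_neqAle eq_sym kn0.
  have apos : 0 < alpha by move: eps4 a2'; lra.
  (* The preimage of tau under the increasing affine map is a lower bound of [T], so the inequality
     passes to the infimum. *)
  have lbx : lbound T ((tau / alpha - 1) / kappa + 2).
    move=> t Tt; rewrite -lerBrDr ler_pdivrMr // lerBlDl ler_pdivrMr //.
    by have := step t Tt; rewrite mulrC [kappa * _]mulrC.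
  have := lb_le_inf Tinf.1 lbx; rewrite -/tau.
  rewrite -lerBrDr ler_pdivrMr // lerBlDl ler_pdivrMr //.
  by rewrite mulrC [kappa * _]mulrC.
have := @contraction_bound R (alpha - 2) kappa eps (tau - 2) k0 k1.
have : eps <= (tau - 2) / 5 by rewrite ge_min lexx orbT.
move=> epstau H.
suff : tau - 2 <= 4 * eps by lra.
apply: H => //; first by rewrite subr_ge0 ltW.
by move: tau_step; rewrite subrK; lra.
Qed.
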